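(* Let $0<a<b$, $q>1$ and $s\in(0,1)$, and let $M>0$ be such that $s(1-s)t^{s-2}\le M$ for all $t\in[a,b]$. Write $A=A(a,b)$. Then for all $x\in[a,b]$ $$\left|L_s^s(a,b)-x^s+s(x-A)x^{s-1}\right|\le M\left(\frac{3(s^2+3s+4)}{(s+1)(s+2)(s+3)}\right)^{\frac1q}\left[\frac{1}{24}(b-a)^2+\frac12(x-A)^2\right].$$ In particular, taking $x=A$, $$\left|L_s^s(a,b)-A^s\right|\le\frac{M}{24}\left(\frac{3(s^2+3s+4)}{(s+1)(s+2)(s+3)}\right)^{\frac1q}(b-a)^2.$$
   Context: For $a,b>0$ with $a\neq b$: the arithmetic mean is $A(a,b)=\frac{a+b}{2}$; the generalized log-mean is $L_p(a,b)=\left[\frac{b^{p+1}-a^{p+1}}{(p+1)(b-a)}\right]^{1/p}$ for $p\in\mathbb{R}\setminus\{-1,0\}$; and $L_s^s(a,b)=(L_s(a,b))^s$. *)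

(* Defs.v *)
From Stdlib Require Export Reals.
Open Scope R_scope.

(* [Rpower x y] is the real power x^y only for x > 0.  Both means are meant for
   a, b > 0, and [gen_log_mean] for a <> b and p different from -1 and 0; the
   base of its outer power is then positive. *)

Definition arith_mean (a b : R) : R := (a + b) / 2.

Definition gen_log_mean (p a b : R) : R :=
  Rpower ((Rpower b (p + 1) - Rpower a (p + 1)) / ((p + 1) * (b - a))) (1 / p).

(* Main.v *)
Require Import Defs.
From Stdlib Require Import Reals.
From Stdlib Require Import Lra.
From Coquelicot Require Import Coquelicot.
Open Scope R_scope.

(** By Taylor's formula at x, the function f t = t^s with |f''| <= M satisfies
    |f t - f x - (t - x) f' x| <= M (t - x)^2 / 2 on [a, b].  Averaging over t
    in [a, b] gives exactly the bracket (b - a)^2 / 24 + (x - A)^2 / 2, because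
    L_s^s is the mean of f.  The remaining factor is at least 1, since
    3 (s^2 + 3 s + 4) - (s + 1) (s + 2) (s + 3) = (1 - s) (s^2 + 4 s + 6). *)

Lemma nonneg_derive_le (f df : R -> R) (a b : R)
  (hf : forall t, a <= t <= b -> is_derive f t (df t))
  (hdf : forall t, a <= t <= b -> 0 <= df t) (u v : R) :
  a <= u -> u <= v -> v <= b -> f u <= f v.
Proof.
intros hu [huv | <-] hv; [| lra].
destruct (MVT_cor2 f df u v huv) as [c [e hc]].
- intros c hc. apply is_derive_Reals, hf. lra.
- assert (0 <= df c) by (apply hdf; lra). nra.
Qed.

(** By the mean value theorem [f t - f x = f1 c * (t - x)] with [c] between [x] and [t]. As [f1] is
    nondecreasing, replacing [f1 c] by [f1 x] lowers the product on either side of [x]. *)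
Lemma tangent_le (f f1 f2 : R -> R) (a b : R)
  (hf : forall t, a <= t <= b -> is_derive f t (f1 t))
  (hf1 : forall t, a <= t <= b -> is_derive f1 t (f2 t))
  (hf2 : forall t, a <= t <= b -> 0 <= f2 t) (x t : R) :
  a <= x <= b -> a <= t <= b -> f x + f1 x * (t - x) <= f t.
Proof.
intros hx ht.
destruct (Rtotal_order x t) as [h | [<- | h]]; [| lra |].
- destruct (MVT_cor2 f f1 x t h) as [c [e hc]].
  + intros c hc. apply is_derive_Reals, hf. lra.
  + assert (f1 x <= f1 c)
      by (apply (nonneg_derive_le f1 f2 a b hf1 hf2); lra).
    nra.
- destruct (MVT_cor2 f f1 t x h) as [c [e hc]].
  + intros c hc. apply is_derive_Reals, hf. lra.
  + assert (f1 c <= f1 x)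
      by (apply (nonneg_derive_le f1 f2 a b hf1 hf2); lra).
    nra.
Qed.

(** Averages the tangent inequality without integrals: [F] minus an antiderivative of the tangent
    line at [x] is nondecreasing, so its values at [a] and [b] compare. The mean of the tangent line
    is its value at the midpoint. *)
Lemma tangent_le_mean (F f f1 f2 : R -> R) (a b : R)
  (hF : forall t, a <= t <= b -> is_derive F t (f t))
  (hf : forall t, a <= t <= b -> is_derive f t (f1 t))
  (hf1 : forall t, a <= t <= b -> is_derive f1 t (f2 t))
  (hf2 : forall t, a <= t <= b -> 0 <= f2 t) (x : R) :
  a < b -> a <= x <= b ->
  f x + f1 x * ((a + b) / 2 - x) <= (F b - F a) / (b - a).
Proof.
intros hab hx.
assert (h : F a - (f x * a + f1 x * (a - x) ^ 2 / 2)
            <= F b - (f x * b + f1 x * (b - x) ^ 2 / 2)).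
{ apply (nonneg_derive_le (fun t => F t - (f x * t + f1 x * (t - x) ^ 2 / 2))
           (fun t => f t - (f x + f1 x * (t - x))) a b); try lra.
  - intros t ht. auto_derive.
    + eexists; exact (hF t ht).
    + rewrite (is_derive_unique (fun u : R => F u) _ _ (hF t ht)). field.
  - intros t ht. generalize (tangent_le f f1 f2 a b hf hf1 hf2 x t hx ht). lra. }
apply Rmult_le_reg_r with (b - a); [lra |].
unfold Rdiv at 2. rewrite Rmult_assoc, Rinv_l by lra. nra.
Qed.

Lemma mean_tangent_error (F f f1 f2 : R -> R) (a b M x : R)
  (hF : forall t, a <= t <= b -> is_derive F t (f t))
  (hf : forall t, a <= t <= b -> is_derive f t (f1 t))
  (hf1 : forall t, a <= t <= b -> is_derive f1 t (f2 t))
  (hf2 : forall t, a <= t <= b -> Rabs (f2 t) <= M) :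
  a < b -> a <= x <= b ->
  Rabs ((F b - F a) / (b - a) - f x + (x - (a + b) / 2) * f1 x)
  <= M * (1 / 24 * (b - a) ^ 2 + 1 / 2 * (x - (a + b) / 2) ^ 2).
Proof.
intros hab hx.
(* [M t^2 / 2 + e f t] is convex on [a, b] for [e = 1] and for [e = -1]. *)
assert (key : forall e, Rabs e = 1 ->
  - (e * ((F b - F a) / (b - a) - f x + (x - (a + b) / 2) * f1 x))
  <= M * (1 / 24 * (b - a) ^ 2 + 1 / 2 * (x - (a + b) / 2) ^ 2)).
{ intros e he.
  assert (h := tangent_le_mean
    (fun t => M * t ^ 3 / 6 + e * F t) (fun t => M * t ^ 2 / 2 + e * f t)
    (fun t => M * t + e * f1 t) (fun t => M + e * f2 t) a b).
  assert (h' : (M * b ^ 3 / 6 + e * F b - (M * a ^ 3 / 6 + e * F a)) / (b - a)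
    = M * (a ^ 2 + a * b + b ^ 2) / 6 + e * ((F b - F a) / (b - a)))
    by (field; lra).
  cbv beta in h. rewrite h' in h.
  (* The terms in [M] form the bracket: with A the midpoint, (a^2 + ab + b^2)/6 + x^2/2 - xA = (b -
     a)^2/24 + (x - A)^2/2. *)
  enough (h0 : M * x ^ 2 / 2 + e * f x
               + (M * x + e * f1 x) * ((a + b) / 2 - x)
               <= M * (a ^ 2 + a * b + b ^ 2) / 6 + e * ((F b - F a) / (b - a)))
    by lra.
  apply h; try assumption; intros t ht.
  - auto_derive; [eexists; exact (hF t ht) |].
    rewrite (is_derive_unique (fun u : R => F u) _ _ (hF t ht)). field.
  - auto_derive; [eexists; exact (hf t ht) |].
    rewrite (is_derive_unique (fun u : R => f u) _ _ (hf t ht)). field.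
  - auto_derive; [eexists; exact (hf1 t ht) |].
    rewrite (is_derive_unique (fun u : R => f1 u) _ _ (hf1 t ht)). ring.
  - generalize (hf2 t ht) (Rle_abs (- (e * f2 t))).
    rewrite Rabs_Ropp, Rabs_mult, he. lra. }
apply Rabs_le; split.
- generalize (key 1 Rabs_R1). lra.
- assert (h : Rabs (- 1) = 1) by (rewrite Rabs_left1; lra).
  generalize (key (- 1) h). lra.
Qed.

Lemma is_derive_Rpower (p t : R) :
  0 < t -> is_derive (fun u => Rpower u p) t (p * Rpower t (p - 1)).
Proof. intros ht. apply is_derive_Reals, derivable_pt_lim_power, ht. Qed.

(** The outer exponents cancel because the base is positive. The right side is the mean of t^p,
    written with the antiderivative t^(p+1)/(p+1) so that it matches [mean_tangent_error]. *)
Lemma gen_log_mean_pow (p a b : R) : 0 < a -> a < b -> 0 < p ->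
  Rpower (gen_log_mean p a b) p
  = (Rpower b (p + 1) / (p + 1) - Rpower a (p + 1) / (p + 1)) / (b - a).
Proof.
intros ha hab hp. unfold gen_log_mean. rewrite Rpower_mult.
replace (1 / p * p) with 1 by (field; lra).
rewrite Rpower_1; [field; lra |].
apply Rdiv_lt_0_compat.
- assert (Rpower a (p + 1) < Rpower b (p + 1)) by (apply Rlt_Rpower_l; lra).
  lra.
- nra.
Qed.

Lemma Rpower_constant_ge_1 (s r : R) : 0 < s -> s < 1 -> 0 <= r ->
  1 <= Rpower (3 * (s ^ 2 + 3 * s + 4) / ((s + 1) * (s + 2) * (s + 3))) r.
Proof.
intros hs0 hs1 hr.
assert (hd : 0 < (s + 1) * (s + 2) * (s + 3))
  by (repeat apply Rmult_lt_0_compat; lra).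
set (K := _ / _).
assert (hK : 1 <= K).
{ apply Rmult_le_reg_r with (1 := hd). unfold K, Rdiv.
  rewrite (Rmult_assoc (3 * _)), Rinv_l by lra.
  assert (0 <= (1 - s) * (s ^ 2 + 4 * s + 6)) by (apply Rmult_le_pos; nra).
  lra. }
(* With 1 read as K^0, only the exponents 0 and [r] are compared when K > 1; when K = 1 the power is
   exp 0. *)
rewrite <- (Rpower_O K) by lra.
destruct hK as [hK | <-].
- apply Rle_Rpower; lra.
- unfold Rpower. rewrite ln_1, !Rmult_0_r. lra.
Qed.

Lemma mean_power_tangent_error (a b s M x : R) :
  0 < a -> a < b -> 0 < s -> s < 1 ->
  (forall t, a <= t <= b -> s * (1 - s) * Rpower t (s - 2) <= M) ->
  a <= x <= b ->
  Rabs (Rpower (gen_log_mean s a b) s - Rpower x s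
        + s * (x - arith_mean a b) * Rpower x (s - 1))
  <= M * (1 / 24 * (b - a) ^ 2 + 1 / 2 * (x - arith_mean a b) ^ 2).
Proof.
intros ha hab hs0 hs1 hM hx. unfold arith_mean.
rewrite gen_log_mean_pow by assumption.
replace (s * (x - (a + b) / 2) * Rpower x (s - 1))
  with ((x - (a + b) / 2) * (s * Rpower x (s - 1))) by ring.
apply (mean_tangent_error (fun t => Rpower t (s + 1) / (s + 1))
  (fun t => Rpower t s) (fun t => s * Rpower t (s - 1))
  (fun t => s * ((s - 1) * Rpower t (s - 2)))); try assumption.
- intros t ht.
  assert (h := is_derive_Rpower (s + 1) t ltac:(lra)).
  replace (s + 1 - 1) with s in h by ring.
  apply (is_derive_ext (fun u => / (s + 1) * Rpower u (s + 1))).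
  + intros u. unfold Rdiv. apply Rmult_comm.
  + replace (Rpower t s) with (/ (s + 1) * ((s + 1) * Rpower t s))
      by (field; lra).
    apply is_derive_scal, h.
- intros t ht. apply is_derive_Rpower. lra.
- intros t ht. apply is_derive_scal.
  replace (s - 2) with (s - 1 - 1) by ring.
  apply is_derive_Rpower. lra.
(* Since [s - 1 < 0], the second derivative is nonpositive and its absolute value is exactly the
   quantity bounded in [hM]. *)
- intros t ht.
  assert (0 < Rpower t (s - 2)) by apply exp_pos.
  assert (0 <= s * (1 - s) * Rpower t (s - 2))
    by (repeat apply Rmult_le_pos; lra).
  rewrite Rabs_left1 by lra. generalize (hM t ht). lra.
Qed.

Theorem proposition3 (a b q s M : R)
  (ha : 0 < a) (hab : a < b) (hq : 1 < q) (hs0 : 0 < s) (hs1 : s < 1)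
  (hM0 : 0 < M)
  (hM : forall t : R, a <= t <= b -> s * (1 - s) * Rpower t (s - 2) <= M) :
  (forall x : R, a <= x <= b ->
     Rabs (Rpower (gen_log_mean s a b) s - Rpower x s
           + s * (x - arith_mean a b) * Rpower x (s - 1))
     <= M * Rpower (3 * (s ^ 2 + 3 * s + 4) / ((s + 1) * (s + 2) * (s + 3))) (1 / q)
        * (1 / 24 * (b - a) ^ 2 + 1 / 2 * (x - arith_mean a b) ^ 2))
  /\
  Rabs (Rpower (gen_log_mean s a b) s - Rpower (arith_mean a b) s)
  <= M / 24 * Rpower (3 * (s ^ 2 + 3 * s + 4) / ((s + 1) * (s + 2) * (s + 3))) (1 / q)
     * (b - a) ^ 2.
Proof.
assert (hK := Rpower_constant_ge_1 s (1 / q) hs0 hs1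
  ltac:(apply Rlt_le, Rdiv_lt_0_compat; lra)).
set (K := Rpower (_ / _) (1 / q)) in *.
assert (main : forall x, a <= x <= b ->
  Rabs (Rpower (gen_log_mean s a b) s - Rpower x s
        + s * (x - arith_mean a b) * Rpower x (s - 1))
  <= M * K * (1 / 24 * (b - a) ^ 2 + 1 / 2 * (x - arith_mean a b) ^ 2)).
{ intros x hx.
  eapply Rle_trans; [apply (mean_power_tangent_error a b s M x); assumption |].
  (* The bracket is nonnegative and [1 <= K], so the bound with [M] alone implies the one with
     [M * K]. *)
  apply Rmult_le_compat_r; [| nra].
  generalize (pow2_ge_0 (b - a)) (pow2_ge_0 (x - arith_mean a b)). lra. }
split; [exact main |].
assert (hA : a <= arith_mean a b <= b) by (unfold arith_mean; lra).
(* At x = A both the derivative term and the square (x - A)^2 vanish. *)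
specialize (main _ hA). revert main.
rewrite Rminus_diag, Rmult_0_r, Rmult_0_l, Rplus_0_r. lra.
Qed.
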